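(* Let $\mathbb{F}_q$ be a finite field of odd characteristic, let $f\in\mathbb{F}_q[x]$ with $d=\deg(f)$ be such that $\gcd(d,q)=1$, and let $a\in\mathbb{F}_q^\times$ and $b\in\mathbb{F}_q$. Then ${}_{-1}\mathcal{B}_f(a,b)\leq d\cdot(d-1)$.
   Context: $\mathbb{F}_q$ is the finite field with $q$ elements, $\mathbb{F}_q^\times=\mathbb{F}_q\setminus\{0\}$. For $c\in\mathbb{F}_q^\times$, a function $F:\mathbb{F}_q\to\mathbb{F}_q$ and $a,b\in\mathbb{F}_q$, the entry of the $c$-Boomerang Connectivity Table is $${}_c\mathcal{B}_F(a,b)=\left|\{(x,y)\in\mathbb{F}_q^2 \mid F(x+y)-c\cdot F(x)=b,\ \ c\cdot F(x+y+a)-F(x+a)=c\cdot b\}\right|.$$ A polynomial is identified with the function it induces. No permutation property of $f$ is assumed. *)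

(* Defs.v *)
From HB Require Import structures.
From mathcomp Require Import all_boot all_order all_algebra all_field.

Set Implicit Arguments.
Unset Strict Implicit.
Unset Printing Implicit Defensive.

Import GRing.Theory.
Local Open Scope ring_scope.

(* Entry at (a, b) of the c-Boomerang Connectivity Table of G; the notion is
   meant for c != 0, though the count makes sense for every c. *)
Definition cBCT (F : finFieldType) (c : F) (G : F -> F) (a b : F) : nat :=
  #|[set xy : F * F |
      (G (xy.1 + xy.2) - c * G xy.1 == b) &&
      (c * G (xy.1 + xy.2 + a) - G (xy.1 + a) == c * b)]|.

(* Main.v *)
Require Import Defs.
From HB Require Import structures.
From mathcomp Require Import all_boot all_order all_algebra all_field.
From mathcomp Require Import zify.

Set Implicit Arguments.
Unset Strict Implicit.
Unset Printing Implicit Defensive.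

Import GRing.Theory.
Local Open Scope ring_scope.

(** Write [z] for [x + y]. With [c = -1] the two conditions say that
    [f(x) + f(z) = b] and [f(x + a) + f(z + a) = b]. Subtracting [b / 2] from
    [f] makes [b] zero, and subtracting the first equation from the second one
    replaces it by [g(x) + g(z) = 0] where [g(X) = f(X + a) - f(X)]. Since the
    characteristic does not divide [d], [g] has degree exactly [d - 1], so
    Bezout suggests at most [d * (d - 1)] points: the curves
    have no common component, since they have no common point at infinity,
    because [X^d + Y^d] and [X^(d-1) + Y^(d-1)] have a common zero other than
    the origin only if [2 = 0].

    The Bezout bound is proved by hand, in dual form. To a weight [w] on the [r]
    common points attach its moments [m i j = \sum_k w k * x k ^+ i * y k ^+ j].
    An equation [h(x) + h(y) = 0] with [deg h = e] gives
    [m (i + e) j + m i (j + e) = 0] as soon as all moments of smaller total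
    degree vanish ([moment_rel]). Having this for [e = n] and [e = n + 1], where
    [d = n + 1], lets one deduce by induction on the total degree that all
    moments vanish once those with [i <= n] and [j < n] do
    ([moments_eq0_in_degree], [moments_eq0]). Vanishing of all moments forces
    [w = 0] by interpolation ([weight_eq0]), so the [r] by [(n + 1) * n] matrix
    of the monomials [x ^+ i * y ^+ j] evaluated at the points has rank [r]
    ([card_common_zeros]). *)

(** * Moments of a weight on finitely many points of the plane *)

Section Moments.

Variables (F : fieldType) (r : nat) (x y : 'I_r -> F) (w : 'I_r -> F).

Definition moment (i j : nat) : F := \sum_k w k * x k ^+ i * y k ^+ j.

Lemma sum_hornerM (g h : {poly F}) :
  \sum_k w k * g.[x k] * h.[y k] =
  \sum_(i < size g) \sum_(j < size h) g`_i * h`_j * moment i j.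
Proof.
under eq_bigr => k _.
  rewrite -mulrA !horner_coef big_distrlr mulr_sumr.
  under eq_bigr => i _ do rewrite mulr_sumr.
  over.
rewrite exchange_big; apply: eq_bigr => i _.
rewrite exchange_big; apply: eq_bigr => j _.
rewrite /moment mulr_sumr; apply: eq_bigr => k _.
by rewrite /= [in LHS]mulrACA [LHS]mulrCA !mulrA.
Qed.

(** The weight of a point is recovered from the moments by integrating a
    product of univariate polynomials that vanishes at all the other points. *)
Lemma weight_eq0 :
  injective (fun k => (x k, y k)) -> (forall i j, moment i j = 0) ->
  forall k, w k = 0.
Proof.
move=> inj_xy m0 k.
pose others (u : 'I_r -> F) := \prod_(l | u l != u k) ('X - (u l)%:P).
have others_k u : (others u).[u k] != 0.
  rewrite horner_prod prodf_seq_neq0; apply/allP => l _ /=.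
  by apply/implyP => ne; rewrite !hornerE subr_eq0 eq_sym.
have others_l u l : u l != u k -> (others u).[u l] = 0.
  by move=> ne; rewrite horner_prod (bigD1 l) //= !hornerE subrr mul0r.
have := sum_hornerM (others x) (others y).
under [RHS]eq_bigr => i _ do under eq_bigr => j _ do rewrite m0 mulr0.
rewrite [RHS]big1 => [|i _]; last by rewrite big1.
rewrite (bigD1 k) //= [X in _ + X]big1 => [|l l_k].
  move/eqP; rewrite addr0 !mulf_eq0 !(negPf (others_k _)) !orbF.
  by move/eqP.
have [exl|nxl] := eqVneq (x l) (x k); last by rewrite (others_l x) // mulr0 mul0r.
rewrite (others_l y) ?mulr0 //; apply: contra l_k => /eqP eyl.
by apply/eqP/inj_xy; rewrite exl eyl.
Qed.

(** Integrating [x^i y^j (h(x) + h(y)) = 0] gives a relation between moments in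
    which only the leading term of [h] contributes to the top total degree. *)
Lemma moment_rel (h : {poly F}) (e i j : nat) :
    size h = e.+1 -> (forall k, h.[x k] + h.[y k] = 0) ->
    (forall i' j', (i' + j' < i + e + j)%N -> moment i' j' = 0) ->
  moment (i + e)%N j + moment i (j + e)%N = 0.
Proof.
move=> size_h zero_h low0.
have he0 : h`_e != 0.
  by have := lead_coef_eq0 h; rewrite -size_poly_eq0 /lead_coef size_h /= => ->.
have : \sum_k w k * x k ^+ i * y k ^+ j * (h.[x k] + h.[y k]) = 0.
  by rewrite big1 // => k _; rewrite zero_h mulr0.
have -> : \sum_k w k * x k ^+ i * y k ^+ j * (h.[x k] + h.[y k]) =
    \sum_(l < e.+1) h`_l * (moment (i + l)%N j + moment i (j + l)%N).
  under eq_bigr => k _.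
    rewrite !horner_coef size_h -big_split mulr_sumr.
    over.
  rewrite exchange_big; apply: eq_bigr => l _.
  rewrite /moment -big_split mulr_sumr; apply: eq_bigr => k _.
  rewrite /= -!mulrDr !exprD mulrCA; congr (_ * _).
  rewrite mulrDr; congr (_ + _); last by rewrite !mulrA.
  by rewrite -!mulrA [_ ^+ j * _]mulrC.
rewrite big_ord_recr big1 /= => [|l _]; last first.
  by rewrite !low0 ?addr0 ?mulr0 //; have := ltn_ord l; lia.
by move/eqP; rewrite add0r mulf_eq0 (negPf he0) => /eqP.
Qed.

End Moments.

(** * Common zeros of two curves h(X) + h(Y) = 0 of consecutive degrees *)

(** In total degree [N] the two relations combine to
    [m i (j + n + 1) = m (i + 1) (j + n)], so that [m i j = m 0 N] for [j >= n].
    The second relation also gives [m 0 N = - m n (N - n)]: for [N < 2 n] the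
    right-hand side is in the box, and for [N >= 2 n] it equals [- m 0 N], so
    [m 0 N] vanishes either way as [2 != 0]. Entries with [j < n] and [i > n]
    are brought to the case [j >= n] by the second relation. The box
    [i <= n], [j < n] is the one that would serve for [X^(n+1) = Y^n = 0]. *)
Lemma moments_eq0_in_degree (F : fieldType) (m : nat -> nat -> F) (n N : nat) :
    2%:R != 0 :> F ->
    (forall i j, (i + n.+1 + j = N)%N ->
      m (i + n.+1)%N j + m i (j + n.+1)%N = 0) ->
    (forall i j, (i + n + j = N)%N -> m (i + n)%N j + m i (j + n)%N = 0) ->
    (forall i j, (i <= n)%N -> (j < n)%N -> m i j = 0) ->
  forall i j, (i + j = N)%N -> m i j = 0.
Proof.
move=> two0 relS rel box.
have opp_eq u v : u + v = 0 :> F -> u = - v by move/eqP; rewrite addr_eq0 => /eqP.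
have shift i j : (i + j + n.+1 = N)%N -> m i (j + n.+1)%N = m i.+1 (j + n)%N.
  move=> eN; apply: oppr_inj.
  rewrite -(opp_eq _ _ (relS i j _)) ?addnS -?addSn; last lia.
  by apply: opp_eq; apply: rel; lia.
have to_col0 i j : (n <= j)%N -> (i + j = N)%N -> m i j = m 0 N.
  elim: i j => [|i IHi] j le_nj eN; first by rewrite -eN.
  have /subnK ej := le_nj; rewrite -ej -shift; last lia.
  by apply: IHi; lia.
have col0 : (n <= N)%N -> m 0 N = 0.
  move=> le_nN; have [lt_N|le_N] := ltnP (N - n) n.
    have := rel 0%N (N - n)%N; rewrite add0n subnK // subnKC //.
    by move=> /(_ erefl); rewrite box // add0r.
  have := rel 0%N (N - n)%N; rewrite add0n subnK // subnKC //.
  move=> /(_ erefl); rewrite (to_col0 n) //; last lia.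
  by rewrite -mulr2n -mulr_natl => /eqP; rewrite mulf_eq0 (negPf two0) => /eqP.
move=> i j eN; have [le_nj|lt_jn] := leqP n j.
  by rewrite to_col0 // col0 //; lia.
have [le_in|lt_ni] := leqP i n; first exact: box.
have := rel (i - n)%N j; rewrite subnK ?(ltnW lt_ni) // => /(_ eN)/opp_eq ->.
by rewrite to_col0 ?col0 ?oppr0 //; lia.
Qed.

Section CommonZeros.

Variables (F : fieldType) (r n : nat) (x y : 'I_r -> F) (f g : {poly F}).
Hypotheses (two_neq0 : 2%:R != 0 :> F).
Hypotheses (size_f : size f = n.+2) (size_g : size g = n.+1).
Hypotheses (zero_f : forall k, f.[x k] + f.[y k] = 0).
Hypotheses (zero_g : forall k, g.[x k] + g.[y k] = 0).

Lemma moments_eq0 (w : 'I_r -> F) :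
    (forall i j, (i <= n)%N -> (j < n)%N -> moment x y w i j = 0) ->
  forall i j, moment x y w i j = 0.
Proof.
move=> box.
suff allN N i j : (i + j = N)%N -> moment x y w i j = 0.
  by move=> i j; apply: allN erefl.
elim/ltn_ind: N i j => N IHN.
apply: (@moments_eq0_in_degree _ _ n) => // i j eN.
  apply: moment_rel size_f zero_f _ => i' j' lt_N.
  by apply: IHN erefl; rewrite -eN.
apply: moment_rel size_g zero_g _ => i' j' lt_N.
by apply: IHN erefl; rewrite -eN.
Qed.

(** A weight orthogonal to the monomials of the box is zero, that is, the
    evaluation matrix of these monomials has independent rows. *)
Lemma card_common_zeros :
  injective (fun k => (x k, y k)) -> (r <= n.+1 * n)%N.
Proof.
move=> inj_xy.
pose E : 'M[F]_(r, n.+1 * n) :=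
  \matrix_k mxvec (\matrix_(i < n.+1, j < n) (x k ^+ i * y k ^+ j)).
suff /eqP <- : row_free E by exact: rank_leq_col.
rewrite -kermx_eq0; apply/rowV0P => v /sub_kermxP vE0.
suff v0 : forall k, v 0 k = 0 by apply/rowP => k; rewrite v0 mxE.
apply: weight_eq0 inj_xy _; apply: moments_eq0 => i j le_in lt_jn.
have := congr1 (fun u : 'rV_(n.+1 * n) =>
  u 0 (mxvec_index (inord i : 'I_n.+1) (Ordinal lt_jn))) vE0.
rewrite !mxE => <-; apply: eq_bigr => k _.
by rewrite mxE mxvecE mxE inordK // mulrA.
Qed.

End CommonZeros.

(** * Finite differences of a polynomial *)

Lemma coef_XaddC_exp (R : comNzRingType) (a : R) (i k : nat) :
  (('X + a%:P) ^+ i)`_k = a ^+ (i - k) *+ 'C(i, k).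
Proof.
rewrite addrC exprDn coef_sum.
under eq_bigr => j _ do rewrite -polyC_exp coefMn coefCM coefXn.
have [le_ki|lt_ik] := leqP k i; last first.
  rewrite bin_small // big1 // => j _.
  by rewrite (_ : (k == j) = false) ?mulr0 ?mul0rn //; have := ltn_ord j; lia.
have lt_ki : (k < i.+1)%N by [].
rewrite (bigD1 (Ordinal lt_ki)) //= eqxx mulr1 big1 ?addr0 // => j ne_jk.
by rewrite eq_sym (_ : (j == k :> nat) = false) ?mulr0 ?mul0rn //; exact/negbTE.
Qed.

(** The two leading coefficients of [f(X + a)] are [f_d] and
    [f_(d-1) + d a f_d], so the difference has leading coefficient [d a f_d]. *)
Lemma size_finite_difference (F : fieldType) (f : {poly F}) (a : F) (n : nat) :
    a != 0 -> n.+1%:R != 0 :> F -> size f = n.+2 ->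
  size (f \Po ('X + a%:P) - f) = n.+1.
Proof.
move=> a0 d0 size_f.
have coef_comp k : (f \Po ('X + a%:P))`_k =
    \sum_(i < n.+2) f`_i * (a ^+ (i - k) *+ 'C(i, k)).
  by rewrite coef_comp_poly size_f; under eq_bigr => i _ do rewrite coef_XaddC_exp.
have below k : (\sum_(i < k) f`_i * (a ^+ (i - k) *+ 'C(i, k))) = 0.
  by rewrite big1 // => i _; rewrite bin_small // mulr0n mulr0.
apply/eqP; rewrite eqn_leq; apply/andP; split.
  apply/leq_sizeP => k le_k; rewrite coefB coef_comp.
  have [->|ne_k] := eqVneq k n.+1.
    by rewrite big_ord_recr below subnn binn /= mulr1n mulr1 add0r subrr.
  rewrite [f`_k]nth_default ?size_f; last lia.
  rewrite subr0 big1 // => i _.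
  by rewrite bin_small ?mulr0n ?mulr0 //; have := ltn_ord i; lia.
rewrite ltnNge; apply/negP => /leq_sizeP /(_ n (leqnn n)) /eqP.
rewrite coefB coef_comp !big_ord_recr /= below subnn binn subSnn binSn.
rewrite mulr1n mulr1 add0r addrAC subrr add0r expr1 -mulr_natr !mulf_eq0.
rewrite (negPf a0) (negPf d0) !orbF.
have := lead_coef_eq0 f; rewrite -size_poly_eq0 /lead_coef size_f /=.
by move=> ->.
Qed.

(** * The boomerang bound *)

Lemma natr_neq0_coprime_card (F : finFieldType) (d : nat) :
  coprime d #|F| -> d%:R != 0 :> F.
Proof.
have [p p_pr charFp] := finPcharP F.
move=> co; rewrite -(dvdn_pcharf charFp); apply/negP => p_d.
have := card_pprimeChar charFp; set e := logn _ _ => cardF.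
have e_gt0 : (0 < e)%N.
  by case: e cardF => // card1; have := finNzRing_gt1 F; rewrite card1.
have p_q : (p %| #|F|)%N by rewrite cardF dvdn_exp.
have : (p %| gcdn d #|F|)%N by rewrite dvdn_gcd p_d.
by rewrite (eqP co) dvdn1 => /eqP p1; rewrite p1 in p_pr.
Qed.

Theorem theorem18 (F : finFieldType) (p : nat) (charFp : p \in [pchar F])
    (p_odd : odd p) (f : {poly F}) (d : nat) (deg_f : d = (size f).-1)
    (coprime_dq : coprime d #|F|) (a b : F) (a_neq0 : a != 0) :
  (cBCT (-1)%R (fun x => f.[x]%R) a b <= d * (d - 1))%N.
Proof.
have two0 : 2%:R != 0 :> F.
  rewrite -(dvdn_pcharf charFp) dvdn_prime2 ?(pcharf_prime charFp) //.
  by apply: contraL p_odd => /eqP ->.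
have d0 := natr_neq0_coprime_card coprime_dq.
case: d => [|n] in deg_f d0 {coprime_dq} *; first by rewrite eqxx in d0.
have size_f : size f = n.+2 by case: (size f) deg_f => //= s ->.
pose f0 := f - (b / 2%:R)%:P; pose g := f \Po ('X + a%:P) - f.
have size_f0 : size f0 = n.+2.
  rewrite size_polyDl size_f // size_polyN.
  exact: leq_ltn_trans (size_polyC_leq1 _) _.
rewrite /cBCT subn1 /=; set S := [set _ | _].
pose x (k : 'I_#|S|) := (enum_val k).1.
pose z (k : 'I_#|S|) := (enum_val k).1 + (enum_val k).2.
have eqs k : f.[z k] + f.[x k] = b /\ f.[z k + a] + f.[x k + a] = b.
  have := enum_valP k; rewrite inE !mulN1r opprK -opprD eqr_opp.
  by case/andP => /eqP ? /eqP ?.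
apply: (@card_common_zeros F #|S| n x z f0 g) => //.
- exact: size_finite_difference.
- move=> k; have [e1 _] := eqs k; rewrite /f0 !hornerD !hornerN
    !hornerC addrACA [f.[x k] + _]addrC e1.
  by rewrite -opprD -mulr2n -[_ / _ *+ 2]mulr_natr divfK // subrr.
- move=> k; have [e1 e2] := eqs k; rewrite /g !hornerD !hornerN !horner_comp
    !hornerD !hornerX !hornerC.
  by rewrite addrACA -opprD [f.[x k + a] + _]addrC e2 [f.[x k] + _]addrC e1 subrr.
move=> k l [exx ezz]; apply: enum_val_inj; rewrite [LHS]surjective_pairing.
rewrite [RHS]surjective_pairing; move: exx ezz; rewrite /x /z => ->.
by move/addrI->.
Qed.
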